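(* Let $e\ge 1$ be an integer and let $(a,b)\in\mathbb{N}^2$ be such that $0\le a\le q-1$ and $0\le b-ea$. Let $k_{\mathbb{A},e}(a,b)$ and $d_{\mathbb{A},e}(a,b)$ denote the dimension and the minimum distance of the code $C_{\mathbb{A},e}(a,b)\subset\mathbb{F}_q^{q^2}$. Set $$s_{\mathbb{A}}:=\frac{b+1-q}{e},\qquad \widetilde{s}_{\mathbb{A}}:=\begin{cases}\min\{\lfloor s_{\mathbb{A}}\rfloor,a\}&\text{if } s_{\mathbb{A}}\ge0,\\-1&\text{otherwise.}\end{cases}$$ Then $$k_{\mathbb{A},e}(a,b)=(\widetilde{s}_{\mathbb{A}}+1)q+(a-\widetilde{s}_{\mathbb{A}})\left(b+1-e\left(\frac{a+\widetilde{s}_{\mathbb{A}}+1}{2}\right)\right),$$ and the minimum distance is given as follows: (i) if $q-1>b$, then $d_{\mathbb{A},e}(a,b)=q(q-b)$; (ii) if $b-ea<q-1\le b$, then $d_{\mathbb{A},e}(a,b)=q-\left\lfloor\frac{b-q+1}{e}\right\rfloor$; (iii) if $q-1\le b-ea$, then $d_{\mathbb{A},e}(a,b)=q-a$.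
   Context: $q$ is a prime power, $\mathbb{F}_q=\{\alpha_1,\dots,\alpha_q\}$ is the field with $q$ elements, $\mathbb{N}=\{0,1,2,\dots\}$, and $0^0:=1$. The minimum distance of a linear code is the minimal Hamming weight of its nonzero words. For $a,b\in\mathbb{N}$, let $L_*(aS_e+bF_e)$ be the $\mathbb{F}_q$-span of the monomials $X_1^{d_1}X_2^{d_2}T_1^{c_1}T_2^{c_2}$ with nonnegative exponents satisfying $d_1+d_2=a$ and $c_1+c_2-ed_1=b-ea$. Let $C_e(a,b)\subset\mathbb{F}_q^{(q+1)^2}$ be the set of $(q+1)\times(q+1)$ matrices $\big(f(x_1,x_2,t_1,t_2)\big)$, $f\in L_*(aS_e+bF_e)$, with rows indexed by $(t_1,t_2)$ and columns by $(x_1,x_2)$, each running over $(0,1),(1,\alpha_1),\dots,(1,\alpha_q)$ in this order. The code $C_{\mathbb{A},e}(a,b)\subset\mathbb{F}_q^{q^2}$ is obtained from $C_e(a,b)$ by deleting the first row and the first column of every codeword. *)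

(* Defs.v *)
From HB Require Import structures.
From mathcomp Require Import all_boot all_order all_algebra.
From mathcomp Require Import mpoly.

Set Implicit Arguments.
Unset Strict Implicit.
Unset Printing Implicit Defensive.

Import Order.TTheory GRing.Theory Num.Theory.
Local Open Scope ring_scope.

(* The variables X_1, X_2, T_1, T_2 are numbered 0, 1, 2, 3, in this order. *)
Definition iX1 : 'I_4 := @Ordinal 4 0 isT.
Definition iX2 : 'I_4 := @Ordinal 4 1 isT.
Definition iT1 : 'I_4 := @Ordinal 4 2 isT.
Definition iT2 : 'I_4 := @Ordinal 4 3 isT.

Definition Lmonomial (e a b : nat) (m : 'X_{1..4}) : bool :=
  (m iX1 + m iX2 == a)%N &&
  ((m iT1 + m iT2)%N%:Z - (e * m iX1)%N%:Z == b%:Z - (e * a)%N%:Z).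

Definition Lstar (F : fieldType) (e a b : nat) (f : {mpoly F[4]}) : Prop :=
  exists s : seq (F * 'X_{1..4}),
    all (fun cm => Lmonomial e a b cm.2) s /\
    f = \sum_(cm <- s) cm.1 *: 'X_[cm.2].

(* The points (0,1), (1,alpha_1), ..., (1,alpha_q), in this order. *)
Definition point (F : fieldType) (q : nat) (alpha : 'I_q -> F) (i : 'I_q.+1) :
    F * F :=
  if unlift ord0 i is Some j then (1, alpha j) else (0, 1).

Definition eval4 (F : fieldType) (f : {mpoly F[4]}) (x t : F * F) : F :=
  f.@[tnth [tuple x.1; x.2; t.1; t.2]].

Definition eval_mx (F : fieldType) (q : nat) (alpha : 'I_q -> F)
    (f : {mpoly F[4]}) : 'M[F]_(q.+1) :=
  \matrix_(i, j) eval4 f (point alpha j) (point alpha i).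

Definition code (F : fieldType) (q : nat) (alpha : 'I_q -> F) (e a b : nat)
    (M : 'M[F]_(q.+1)) : Prop :=
  exists2 f : {mpoly F[4]}, Lstar e a b f & M = eval_mx alpha f.

Definition affine_code (F : fieldType) (q : nat) (alpha : 'I_q -> F)
    (e a b : nat) (M : 'M[F]_q) : Prop :=
  exists2 N : 'M[F]_(q.+1),
    code alpha e a b N & M = row' ord0 (col' ord0 N).

Definition has_dim (K : fieldType) (V : vectType K) (C : V -> Prop) (k : nat) :
    Prop :=
  exists2 U : {vspace V}, (forall v, v \in U <-> C v) & \dim U = k.

Definition hweight (F : fieldType) (m n : nat) (M : 'M[F]_(m, n)) : nat :=
  #|[set ij : 'I_m * 'I_n | M ij.1 ij.2 != 0]|.

Definition has_min_dist (F : fieldType) (m n : nat) (C : 'M[F]_(m, n) -> Prop)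
    (d : nat) : Prop :=
  (exists M, [/\ C M, M != 0 & hweight M = d]) /\
  (forall M, C M -> M != 0 -> (d <= hweight M)%N).

Definition sA (q e b : nat) : rat := (b%:R + 1 - q%:R) / e%:R.

Definition sA_tilde (q e a b : nat) : int :=
  if 0 <= sA q e b then Num.min (Num.floor (sA q e b)) a%:Z else -1.

(* Main.v *)
(* Evaluating x^d t^c (d = deg X_2, c = deg T_2) at the q^2 affine points, with
   rows indexed by t, turns the code into {W^T A W}, where W is the square
   Vandermonde matrix of F_q and A ranges over the matrices supported on the
   exponents (c, d) with c, d < q, d <= a and c + e d <= b: higher powers of t
   bring nothing new, since in such a column d every c < q is already allowed.
   As W is invertible, the dimension is the number of these exponents.

   For the distance, let d be the largest x-degree in a nonzero word.  Its
   coefficient is a polynomial in t of degree <= min(b - e d, q - 1), nonzero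
   on at least q - min(b - e d, q - 1) rows, and each such row has weight at
   least q - d.  Minimising the product over d gives the lower bound, which is
   attained by products of linear factors in t and in x. *)
Require Import Defs.
From mathcomp Require Import all_boot all_order all_algebra.
From mathcomp Require Import mpoly zify ring.
Import Order.TTheory GRing.Theory Num.Theory.
Local Open Scope ring_scope.

(** * Vandermonde matrices and nonzero values of polynomials *)

Lemma unitmx_Vandermonde (F : fieldType) n (a : 'rV[F]_n) :
  injective (a 0) -> Vandermonde n a \in unitmx.
Proof.
move=> inj_a; rewrite unitmxE det_Vandermonde unitfE.
apply/prodf_neq0 => i _; apply/prodf_neq0 => j lt_ij.
rewrite subr_eq0; apply/eqP => /inj_a eq_ji.
by rewrite eq_ji ltnn in lt_ij.
Qed.

Lemma card_nonroots (F : idomainType) n (alpha : 'I_n -> F) (p : {poly F}) m :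
    injective alpha -> p != 0 -> (size p <= m.+1)%N ->
  (n - m <= #|[set i | p.[alpha i] != 0%R]|)%N.
Proof.
move=> inj_alpha p_neq0 size_p.
have := @max_poly_roots _ p [seq alpha i | i <- enum [set i | root p (alpha i)]].
rewrite map_inj_uniq ?enum_uniq // size_map -cardE => /(_ p_neq0) lt_roots.
have{lt_roots} lt_roots : (#|[set i | root p (alpha i)]| < size p)%N.
  by apply: lt_roots => //; apply/allP => _ /mapP[i + ->]; rewrite mem_enum inE.
have := cardsC [set i | root p (alpha i)]; rewrite card_ord.
have -> : ~: [set i | root p (alpha i)] = [set i | p.[alpha i] != 0].
  by apply/setP => i; rewrite !inE rootE.
lia.
Qed.

(** Here [u] is read as the coefficient vector of a polynomial of degree at most [m]; the bound
    serves once in the variable [t] and once in [x]. *)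
Lemma card_nonzero_eval (F : idomainType) n (alpha u : 'I_n -> F) (k : 'I_n) m :
    injective alpha -> u k != 0 -> (forall d : 'I_n, (m < d)%N -> u d = 0) ->
  (n - m <= #|[set i | (\sum_(d < n) alpha i ^+ d * u d)%R != 0%R]|)%N.
Proof.
move=> inj_alpha uk u0; pose p : {poly F} := \sum_(d < n) u d *: 'X^d.
have coef_p (d : 'I_n) : p`_d = u d.
  rewrite coef_sum (bigD1 d) //= coefZ coefXn eqxx mulr1 big1 ?addr0 // => j.
  by rewrite coefZ coefXn eq_sym => /negPf; rewrite -val_eqE /= => ->; rewrite mulr0.
have -> : [set i | \sum_(d < n) alpha i ^+ d * u d != 0]
          = [set i | p.[alpha i] != 0].
  apply/setP => i; rewrite !inE horner_sum; congr (_ != 0).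
  by apply: eq_bigr => d _; rewrite hornerZ hornerXn mulrC.
apply: card_nonroots => //.
  by apply: contra_neq uk => p0; rewrite -coef_p p0 coef0.
apply/leq_sizeP => j lt_mj; rewrite coef_sum big1 // => d _.
rewrite coefZ coefXn; case: eqP => [jd|_]; last by rewrite mulr0.
by rewrite u0 ?mul0r // -jd.
Qed.

Definition vander {F : fieldType} {q} (alpha : 'I_q -> F) : 'M[F]_q :=
  Vandermonde q (\row_j alpha j).

Lemma unitmx_vander {F : fieldType} {q} {alpha : 'I_q -> F} :
  injective alpha -> vander alpha \in unitmx.
Proof.
by move=> inj_alpha; apply: unitmx_Vandermonde => i j; rewrite !mxE => /inj_alpha.
Qed.

(** * Weight and dimension of codes given by a support *)

Lemma hweight_rows (F : fieldType) m n (M : 'M[F]_(m, n)) :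
  hweight M = (\sum_i #|[set j | M i j != 0%R]|)%N.
Proof.
rewrite /hweight -sum1_card.
under [RHS]eq_bigr => i _ do rewrite -sum1_card.
rewrite pair_big_dep /=; apply: eq_bigl => -[i j].
by rewrite !inE.
Qed.

Lemma hweight_ge (F : fieldType) q (alpha : 'I_q -> F) (A : 'M[F]_q)
    (c0 d0 : 'I_q) n :
    injective alpha -> A c0 d0 != 0 ->
    (forall c d : 'I_q, (d0 < d)%N -> A c d = 0) ->
    (forall c : 'I_q, (n < c)%N -> A c d0 = 0) ->
  ((q - n) * (q - d0) <= hweight ((vander alpha)^T *m A *m vander alpha))%N.
Proof.
move=> inj_alpha A0 Ad Ac; rewrite hweight_rows.
(* Row [i] of [B] lists the coefficients in [x] of the word at [t = alpha i]; [I] collects the rows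
   where the leading one, at [x ^ d0], does not vanish. *)
pose B := (vander alpha)^T *m A.
pose I := [set i | B i d0 != 0].
have cardI : (q - n <= #|I|)%N.
  have := @card_nonzero_eval F q alpha (A^~ d0) c0 n inj_alpha A0 Ac.
  congr (_ <= #|pred_of_set _|)%N; apply/setP => i; rewrite !inE mxE.
  by congr (_ != 0); apply: eq_bigr => c _; rewrite !mxE.
apply: leq_trans (_ : \sum_(i in I) (q - d0) <= _)%N.
  by rewrite sum_nat_const leq_mul2r cardI orbT.
rewrite [X in (_ <= X)%N](bigID (mem I)) /=.
apply: leq_trans (leq_addr _ _); apply: leq_sum => i; rewrite inE => Bi.
have Bd (d : 'I_q) : (d0 < d)%N -> B i d = 0.
  by move=> lt_d; rewrite mxE big1 // => c _; rewrite Ad ?mulr0.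
have := @card_nonzero_eval F q alpha (B i) d0 d0 inj_alpha Bi Bd.
congr (_ <= #|pred_of_set _|)%N; apply/setP => j; rewrite !inE [in RHS]mxE.
by congr (_ != 0); apply: eq_bigr => d _; rewrite !mxE mulrC.
Qed.

(* [A c d] is the coefficient of [t ^ c * x ^ d]. *)
Definition suppcode {F : fieldType} {q} (alpha : 'I_q -> F)
    (S : {set 'I_q * 'I_q}) (M : 'M[F]_q) : Prop :=
  exists2 A : 'M[F]_q, (forall c d, (c, d) \notin S -> A c d = 0)
    & M = (vander alpha)^T *m A *m vander alpha.

(** The words coming from the matrix units indexed by [S] form a basis; they are free because the
    Vandermonde matrix is invertible. *)
Lemma has_dim_suppcode (F : fieldType) q (alpha : 'I_q -> F)
    (S : {set 'I_q * 'I_q}) :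
  injective alpha -> has_dim (suppcode alpha S) #|S|.
Proof.
move=> inj_alpha; have unitW := unitmx_vander inj_alpha.
have unitWT : (vander alpha)^T \in unitmx by rewrite unitmx_tr.
pose D (k : 'I_#|S|) : 'M[F]_q := delta_mx (enum_val k).1 (enum_val k).2.
pose X := [tuple (vander alpha)^T *m D k *m vander alpha | k < #|S|].
have XE (r : 'I_#|S| -> F) :
  \sum_k r k *: X`_k = (vander alpha)^T *m (\sum_k r k *: D k) *m vander alpha.
  rewrite mulmx_sumr mulmx_suml; apply: eq_bigr => k _.
  by rewrite -tnth_nth tnth_mktuple -scalemxAr -scalemxAl.
have DE (r : 'I_#|S| -> F) c d : (\sum_k r k *: D k) c d
    = \sum_(k | enum_val k == (c, d)) r k.
  rewrite summxE [RHS]big_mkcond; apply: eq_bigr => k _; rewrite !mxE /=.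
  rewrite -pair_eqE /= ![_ == c]eq_sym ![_ == d]eq_sym.
  by case: ifP => _; rewrite ?mulr1 ?mulr0.
exists <<X>>%VS; last first.
  suff /eqP -> : free X by rewrite size_tuple.
  apply/freeP => r; rewrite XE => r0 k.
  have {}r0 : \sum_k r k *: D k = 0.
    apply: (can_inj (mulKmx unitWT)); apply: (can_inj (mulmxK unitW)).
    by rewrite r0 mulmx0 mul0mx.
  have := DE r (enum_val k).1 (enum_val k).2; rewrite r0 mxE (big_pred1 k) //.
  by move=> j; rewrite -surjective_pairing (inj_eq enum_val_inj).
move=> v; split=> [/coord_span ->|[A A0 ->]].
  rewrite XE; eexists; last by []; move=> c d cdS.
  rewrite DE big1 // => k /eqP kE; move: (enum_valP k); rewrite kE.
  by rewrite (negPf cdS).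
rewrite [A]matrix_sum_delta mulmx_sumr mulmx_suml memv_suml // => c _.
rewrite mulmx_sumr mulmx_suml memv_suml // => d _.
rewrite -scalemxAr -scalemxAl; have [cdS|/A0->] := boolP ((c, d) \in S); last first.
  by rewrite scale0r mem0v.
apply: memvZ; apply: memv_span; apply/tnthP.
by exists (enum_rank_in cdS (c, d)); rewrite tnth_mktuple /D enum_rankK_in.
Qed.

(** * From the affine code to its exponents *)

(** With [d_1 = a - d_2], the second degree condition reads [c_1 + c_2 = b - e * d_2]. The two
    bounds say that [d_1] and [c_1] are nonnegative. *)
Definition monomials (q e a b : nat) : {set 'I_q * 'I_q} :=
  [set cd : 'I_q * 'I_q | (cd.2 <= a)%N && (cd.1 + e * cd.2 <= b)%N].

Lemma affine_eval_mx (F : fieldType) q (alpha : 'I_q -> F) (f : {mpoly F[4]}) :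
  row' ord0 (col' ord0 (eval_mx alpha f))
  = \matrix_(i, j) eval4 f (1, alpha j) (1, alpha i).
Proof. by apply/matrixP => i j; rewrite !mxE /point !liftK. Qed.

Lemma affine_eval_monomial (F : fieldType) q (alpha : 'I_q -> F)
    (m : 'X_{1..4}) i j :
  (\matrix_(i, j) eval4 'X_[m] (1, alpha j) (1, alpha i)) i j
  = alpha i ^+ m iT2 * alpha j ^+ m iX2.
Proof.
rewrite mxE /eval4 mevalX !big_ord_recl big_ord0 /=.
rewrite !(tnth_nth 0) /= !expr1n !mul1r mulr1 mulrC.
by congr (_ ^+ m _ * _ ^+ m _); apply/val_inj.
Qed.

Lemma vander_sandwichE (F : fieldType) q (alpha : 'I_q -> F) (A : 'M[F]_q) i j :
  ((vander alpha)^T *m A *m vander alpha) i j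
  = \sum_(c < q) \sum_(d < q) alpha i ^+ c * A c d * alpha j ^+ d.
Proof.
rewrite exchange_big mxE; apply: eq_bigr => d _; rewrite mxE mulr_suml.
by apply: eq_bigr => c _; rewrite !mxE.
Qed.

Lemma affine_codeP (F : fieldType) q (alpha : 'I_q -> F) e a b (M : 'M[F]_q) :
    injective alpha -> (a < q)%N -> (e * a <= b)%N ->
  affine_code alpha e a b M <-> suppcode alpha (monomials q e a b) M.
Proof.
move=> inj_alpha lt_aq le_eab.
have unitWT : (vander alpha)^T \in unitmx by rewrite unitmx_tr unitmx_vander.
split=> [[_ [f [s [/allP sL ->]] ->] ->]|[A A0 ->]].
  (* The subspace [U] gives closure under linear combinations, which leaves a single monomial to
     treat. *)
  have [U UP _] := has_dim_suppcode _ _ alpha (monomials q e a b) inj_alpha.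
  rewrite affine_eval_mx.
  have -> : \matrix_(i, j)
      eval4 (\sum_(cm <- s) cm.1 *: 'X_[cm.2]) (1, alpha j) (1, alpha i)
    = \sum_(cm <- s) cm.1 *: (\matrix_(i, j) eval4 'X_[cm.2] (1, alpha j) (1, alpha i)).
    apply/matrixP => i j; rewrite summxE mxE /eval4 raddf_sum.
    by apply: eq_bigr => cm _; rewrite !mxE /= mevalZ.
  apply/UP; rewrite big_seq; apply: memv_suml => -[k m] /sL /=.
  rewrite /Lmonomial => /andP[/eqP m12 /eqP mT]; apply/memvZ/UP.
  have lt_m2 : (m iX2 < q)%N by lia.
  (* Since [m iT2] may be [q] or more, the coefficients in [t] are obtained by interpolation:
     [invmx (vander alpha)^T *m u] is the polynomial of degree below [q] with the same values. *)
  pose u : 'cV[F]_q := \col_i alpha i ^+ m iT2.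
  exists (invmx (vander alpha)^T *m u *m delta_mx 0 (Ordinal lt_m2)).
    move=> c d; rewrite inE /= negb_and -!ltnNge => cd.
    have [/(congr1 val) /= dE|nd] := eqVneq d (Ordinal lt_m2); last first.
      by rewrite mxE big1 // => l _; rewrite [X in _ * X]mxE (negPf nd) andbF mulr0.
    (* [(c, d)] is excluded with [d = m iX2] and [c < q], so [t ^ m iT2] is reduced. *)
    have lt_mT : (m iT2 < q)%N by have := ltn_ord c; nia.
    have -> : u = (vander alpha)^T *m delta_mx (Ordinal lt_mT) 0.
      apply/colP => i; by rewrite -colE !mxE.
    rewrite mulKmx // mul_delta_mx mxE andbC.
    case: (c =P _) => [/(congr1 val) /= cE|]; last by rewrite andbF.
    nia.
  apply/matrixP => i j.
  rewrite affine_eval_monomial !mulmxA mulmxV // mul1mx -mulmxA.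
  by rewrite -rowE mxE big_ord1 !mxE.
(* Homogenisation: [X_1] and [T_1] absorb the missing degrees, and on [monomials q e a b] the
   subtractions are not truncated. *)
pose mon (cd : 'I_q * 'I_q) : 'X_{1..4} :=
  [multinom nth 0 [:: a - cd.2; nat_of_ord cd.2;
                      b - e * cd.2 - cd.1; nat_of_ord cd.1]%N i | i < 4].
pose s := [seq (A cd.1 cd.2, mon cd) | cd <- enum (monomials q e a b)].
pose f : {mpoly F[4]} := \sum_(cm <- s) cm.1 *: 'X_[cm.2].
exists (eval_mx alpha f).
  exists f => //; exists s; split=> //; apply/allP => _ /mapP[cd + ->] /=.
  rewrite mem_enum inE => /andP[le_da le_b].
  rewrite /Lmonomial !mnmE /=; nia.
rewrite affine_eval_mx; apply/matrixP => i j.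
rewrite [RHS]mxE /eval4 raddf_sum /= big_map big_enum /=.
rewrite vander_sandwichE pair_big /= (bigID (mem (monomials q e a b))) /=.
rewrite [X in _ + X]big1 ?addr0 => [|[c d] /A0 /= ->]; last first.
  by rewrite mulr0 mul0r.
apply: eq_bigr => -[c d] _.
have := affine_eval_monomial F q alpha (mon (c, d)) i j.
rewrite mxE mevalZ /eval4 /= => ->; rewrite !mnmE /=.
by rewrite mulrCA mulrA.
Qed.

(** * Counting the exponents *)

(** The bound on [e * N.-1] prevents truncation, so this is an arithmetic series: the number of
    terms times their mean. *)
Lemma sum_arith (B e n N : nat) : (n <= N)%N -> (e * N.-1 <= B)%N ->
  (\sum_(n <= d < N) (B - e * d))%N%:R
  = (N%:R - n%:R) * (B%:R - e%:R * ((N%:R + n%:R - 1) / 2)) :> rat.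
Proof.
move=> le_nN; rewrite -(subnKC le_nN); elim: (N - n)%N => [|m IHm] le_B.
  by rewrite addn0 big_geq // subrr mul0r.
rewrite addnS big_nat_recr /= ?leq_addr // natrD IHm; last first.
  by apply: leq_trans le_B; rewrite leq_mul2l addnS /= leq_pred orbT.
rewrite natrB; last by rewrite addnS in le_B.
rewrite natrM -[in RHS]addn1 !natrD; by field.
Qed.

Lemma card_ord_lt q n : #|[set c : 'I_q | (c < n)%N]| = minn q n.
Proof.
rewrite -sum1_card; under eq_bigl do rewrite inE.
case: (leqP q n) => [le_qn|/ltnW le_nq]; last first.
  by rewrite (big_ord_narrow le_nq) sum_nat_const card_ord muln1.
rewrite -[RHS]card_ord -sum1_card; apply: eq_bigl => c.
by rewrite (leq_trans (ltn_ord c)).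
Qed.

(** For fixed [d], the admissible [c] are those below both [q] and [b.+1 - e * d]. *)
Lemma card_monomials q e a b : (a < q)%N ->
  #|monomials q e a b| = (\sum_(0 <= d < a.+1) minn q (b.+1 - e * d))%N.
Proof.
move=> lt_aq; rewrite big_mkord (big_ord_widen q (fun d => minn q (b.+1 - e * d))) //.
under [RHS]eq_bigr do rewrite -card_ord_lt -sum1_card.
rewrite (exchange_big_dep xpredT) //= pair_big_dep -sum1_card.
apply: eq_bigl => -[c d]; rewrite !inE /= ltnS; lia.
Qed.

Lemma floor_divn m e : (0 < e)%N ->
  Num.floor (m%:R / e%:R : rat) = (m %/ e)%N%:Z.
Proof.
move=> e_gt0; apply: floor_def; have e_gt0' : 0 < e%:R :> rat by rewrite ltr0n.
rewrite ler_pdivlMr // ltr_pdivrMr //.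
rewrite -[_%:Z + 1]/(_%:Z + 1%:Z) -PoszD -!pmulrn -!natrM ler_nat ltr_nat.
by rewrite leq_divM addn1 ltn_ceil.
Qed.

(** * The minimum distance as a numerical minimum *)

(** Apply [hweight_ge] to the last nonzero column [d] of [A]: a nonzero entry there has
    [c <= b - e * d] by the support condition and [c <= q.-1] as an index. *)
Lemma hweight_suppcode_ge (F : fieldType) q (alpha : 'I_q -> F) e a b
    (M : 'M[F]_q) :
    injective alpha -> suppcode alpha (monomials q e a b) M -> M != 0 ->
  exists2 d, (d <= a)%N && (e * d <= b)%N
    & ((q - minn (b - e * d) q.-1) * (q - d) <= hweight M)%N.
Proof.
move=> inj_alpha [A A0 ->] M_neq0.
have [d1 Ad1] : exists d : 'I_q, [exists c, A c d != 0].
  have [d Ad|Az] := pickP (fun d => [exists c, A c d != 0]); first by exists d.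
  case/eqP: M_neq0; suff -> : A = 0 by rewrite mulmx0 mul0mx.
  apply/matrixP => c d; rewrite mxE; apply/eqP/negbNE.
  by move/negbT: (Az d); rewrite negb_exists => /forallP.
case: (@arg_maxnP _ d1 (fun d => [exists c, A c d != 0]) (@nat_of_ord q) Ad1)
  => d /existsP[c Acd] d_max.
have suppA c' d' : A c' d' != 0 -> (d' <= a)%N && (c' + e * d' <= b)%N.
  by apply: contraNT => cd'; rewrite A0 ?inE.
have /andP[le_da le_cb] := suppA _ _ Acd.
exists (val d); first by rewrite le_da (leq_trans (leq_addl _ _) le_cb).
apply: (hweight_ge _ _ _ _ c) => // [c' d' lt_d|c' lt_c]; apply/eqP.
  by apply: contraLR lt_d => Ac'; rewrite -leqNgt; apply: d_max; apply/existsP; exists c'.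
apply: contraLR lt_c => /suppA /andP[_].
have := ltn_ord c'; rewrite /=; set k := (e * d)%N; lia.
Qed.

(** The word is [p n] in [t] times [p m] in [x], where [p k] is monic of degree [k] and vanishes at
    exactly the first [k] points. *)
Lemma suppcode_product (F : fieldType) q (alpha : 'I_q -> F) e a b n m :
    injective alpha -> (n < q)%N -> (m < q)%N -> (m <= a)%N ->
    (n + e * m <= b)%N ->
  exists M, [/\ suppcode alpha (monomials q e a b) M, M != 0
    & hweight M = ((q - n) * (q - m))%N].
Proof.
move=> inj_alpha lt_nq lt_mq le_ma le_b.
pose r k := [seq alpha i | i <- enum [set i : 'I_q | (i < k)%N]].
pose p k : {poly F} := \prod_(x <- r k) ('X - x%:P).
have size_p k : (k < q)%N -> size (p k) = k.+1.
  by move=> lt_kq; rewrite size_prod_XsubC size_map -cardE card_ord_lt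
    (minn_idPr (ltnW lt_kq)).
have p_eq0 k i : ((p k).[alpha i] == 0) = (i < k)%N.
  by rewrite -rootE root_prod_XsubC mem_map // mem_enum inE.
have p0 k c : (k < q)%N -> (k < c)%N -> (p k)`_c = 0.
  by move=> lt_kq lt_kc; rewrite nth_default // size_p.
pose M := \matrix_(i < q, j < q) ((p n).[alpha i] * (p m).[alpha j]).
have weightE : hweight M = ((q - n) * (q - m))%N.
  have cardC k : (k < q)%N -> #|~: [set i : 'I_q | (i < k)%N]| = (q - k)%N.
    by move=> lt_kq; rewrite cardsCs setCK card_ord card_ord_lt (minn_idPr (ltnW lt_kq)).
  rewrite -(cardC n) // -(cardC m) // -cardsX; apply: eq_card => -[i j].
  by rewrite !inE mxE mulf_eq0 negb_or !p_eq0.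
exists M; split=> //; last first.
  apply: contra_eq_neq weightE => ->; rewrite /hweight eq_card0 => [|ij].
    by rewrite eq_sym -lt0n muln_gt0 !subn_gt0 lt_nq.
  by rewrite !inE mxE eqxx.
exists (\matrix_(c, d) ((p n)`_c * (p m)`_d)).
  move=> c d; rewrite inE /= negb_and -!ltnNge mxE => cd.
  have [lt_nc|le_cn] := ltnP n c; first by rewrite (p0 n) ?mul0r.
  rewrite (p0 m) ?mulr0 //; nia.
apply/matrixP => i j; rewrite vander_sandwichE mxE.
rewrite (horner_coef_wide _ (_ : size (p n) <= q)%N) ?size_p //.
rewrite (horner_coef_wide _ (_ : size (p m) <= q)%N) ?size_p //.
rewrite mulr_suml; apply: eq_bigr => c _; rewrite mulr_sumr; apply: eq_bigr => d _.
by rewrite mxE; ring.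
Qed.

(** The product word of degrees [n] and [m] attains the value, and the last hypothesis compares it
    with the lower bound for every leading degree [d]; only arithmetic remains. *)
Lemma affine_code_min_dist (F : fieldType) q (alpha : 'I_q -> F) e a b n m :
    injective alpha -> (a < q)%N -> (e * a <= b)%N ->
    (n < q)%N -> (m <= a)%N -> (n + e * m <= b)%N ->
    (forall d, (d <= a)%N -> (e * d <= b)%N ->
       ((q - n) * (q - m) <= (q - minn (b - e * d) q.-1) * (q - d))%N) ->
  has_min_dist (affine_code alpha e a b) ((q - n) * (q - m)).
Proof.
move=> inj_alpha lt_aq le_eab lt_nq le_ma le_b bound; split.
  have [M [CM M0 wM]] := suppcode_product _ _ _ e a b n m inj_alpha lt_nq
    (leq_ltn_trans le_ma lt_aq) le_ma le_b.
  by exists M; split=> //; apply/affine_codeP.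
move=> M /affine_codeP CM M0.
have [//|//|//|d /andP[le_da le_edb]] :=
  hweight_suppcode_ge _ _ _ _ _ _ _ inj_alpha (CM _ _ _) M0.
by apply: leq_trans; apply: bound.
Qed.

(** * The dimension formula *)

(** The columns [d < n] are full, with [q] exponents each, and the later ones form an arithmetic
    series. Thus [n] stands for [sA_tilde + 1], and [n = 0] covers the value [-1]. *)
Lemma card_monomials_rat q e a b n : (a < q)%N -> (e * a <= b)%N ->
    (n <= a.+1)%N -> (forall d, (d < n)%N -> (q + e * d <= b.+1)%N) ->
    (forall d, (n <= d <= a)%N -> (b.+1 <= q + e * d)%N) ->
  #|monomials q e a b|%:R = n%:R * q%:R
    + (a%:R - (n%:R - 1)) * (b%:R + 1 - e%:R * ((a%:R + (n%:R - 1) + 1) / 2)) :> rat.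
Proof.
move=> lt_aq le_eab le_na lo hi.
rewrite card_monomials // (big_cat_nat (leq0n n) le_na) /= natrD; congr (_ + _).
  rewrite -natrM -[n in RHS]subn0 -sum_nat_const_nat; congr _%:R.
  by apply: eq_big_nat => d /andP[_ /lo]; lia.
transitivity ((\sum_(n <= d < a.+1) (b.+1 - e * d))%N%:R : rat).
  by congr _%:R; apply: eq_big_nat => d /hi; lia.
rewrite sum_arith //; last by rewrite ltnW.
by rewrite -[b.+1]addn1 -[a.+1]addn1 !natrD; field.
Qed.

Lemma sA_tildeE q e a b : (0 < e)%N ->
  sA_tilde q e a b = if (q <= b.+1)%N then (minn ((b.+1 - q) %/ e) a)%:Z else -1.
Proof.
move=> e_gt0; rewrite /sA_tilde /sA natr1.
have e_gt0' : 0 < e%:R :> rat by rewrite ltr0n.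
rewrite pmulr_lge0 ?invr_gt0 // subr_ge0 ler_nat.
by case: ifP => // le_qb; rewrite -natrB // floor_divn //; lia.
Qed.

Theorem proposition3p9 (F : finFieldType) (q : nat) (hq : #|F| = q)
    (alpha : 'I_q -> F) (halpha : bijective alpha)
    (e a b : nat) (he : (1 <= e)%N) (ha : (a <= q - 1)%N)
    (hb : 0 <= b%:Z - (e * a)%N%:Z) :
  exists k d : nat,
    [/\ has_dim (affine_code alpha e a b) k,
        has_min_dist (affine_code alpha e a b) d,
        (let s : rat := (sA_tilde q e a b)%:~R in
         k%:R = (s + 1) * q%:R
                + (a%:R - s) * (b%:R + 1 - e%:R * ((a%:R + s + 1) / 2)))
      & [/\ b%:Z < q%:Z - 1 -> d%:Z = q%:Z * (q%:Z - b%:Z),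
            b%:Z - (e * a)%N%:Z < q%:Z - 1 <= b%:Z ->
              d%:Z = q%:Z - Num.floor ((b%:R - q%:R + 1) / e%:R : rat)
          & q%:Z - 1 <= b%:Z - (e * a)%N%:Z -> d%:Z = q%:Z - a%:Z]].
Proof.
have q_gt0 : (0 < q)%N by rewrite -hq; apply/card_gt0P; exists 0.
have lt_aq : (a < q)%N by lia.
have le_eab : (e * a <= b)%N by lia.
have inj_alpha := bij_inj halpha.
(* Degrees in [t] and [x] of a word of minimum weight. If [q <= b.+1], then [m] is the largest
   [x]-degree up to [a] that still leaves room for the [t]-degree [q.-1]; otherwise [m = 0]. *)
have [n [m [lt_nq le_ma le_b bound dE]]] : exists n m, [/\ (n < q)%N, (m <= a)%N,
    (n + e * m <= b)%N,
    forall d, (d <= a)%N -> (e * d <= b)%N ->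
       ((q - n) * (q - m) <= (q - minn (b - e * d) q.-1) * (q - d))%N
    & [/\ (b.+1 < q)%N -> n = b /\ m = 0,
          (q <= b.+1 < q + e * a)%N -> n = q.-1 /\ m = ((b.+1 - q) %/ e)%N
        & (q + e * a <= b.+1)%N -> n = q.-1 /\ m = a]].
  case: (ltnP b.+1 q) => [lt_bq|le_qb].
    exists b, 0%N; split; [lia|lia|lia| |by split=> //; lia].
    move=> d le_da le_edb.
    have -> : minn (b - e * d) q.-1 = (b - e * d)%N by lia.
    have le_d : (d <= e * d)%N by rewrite leq_pmull.
    (* It suffices to treat [e = 1], where the two sides differ by [d * (b - d)]. *)
    apply: leq_trans (_ : (q - (b - d)) * (q - d) <= _)%N; last first.
      by rewrite leq_mul2r; apply/orP; right; lia.
    have [k kE] : exists k, b = (d + k)%N by exists (b - d)%N; lia.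
    have [l lE] : exists l, q = (b + l)%N by exists (q - b)%N; lia.
    by rewrite lE kE; nia.
  case: (ltnP b.+1 (q + e * a)) => [lt_b|le_b].
    set s := ((b.+1 - q) %/ e)%N.
    have le_s : (e * s <= b.+1 - q)%N by rewrite mulnC leq_divM.
    have lt_s : (b.+1 - q < e * s.+1)%N by rewrite mulnC ltn_ceil.
    have lt_sa : (s < a)%N by rewrite -(ltn_pmul2l he); lia.
    exists q.-1, s; split; [lia|lia|lia| |by split=> //; lia].
    move=> d le_da le_edb.
    have [le_ds|lt_sd] := leqP d s.
      by apply: leq_mul; lia.
    (* Beyond [s], the factor in [x] drops from [q - s = u + v + 2] to [u + 1], but the factor in
       [t] is at least [v + 2], as each further column costs [e >= 1] degrees in [t]. The product is
       then at least [q - s]. *)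
    have [v vE] : exists v, d = (s + v.+1)%N by exists (d - s).-1; lia.
    have [u uE] : exists u, q = (d + u.+1)%N by exists (q - d).-1; lia.
    apply: leq_trans (_ : v.+2 * u.+1 <= _)%N.
      have le_uv : (u <= v.+2 * u)%N by rewrite leq_pmull.
      have -> : (q - q.-1)%N = 1%N by lia.
      by rewrite mul1n mulnS; lia.
    have le_v : (v <= e * v)%N by rewrite leq_pmull.
    have edE : (e * d = e * s + (e + e * v))%N by rewrite vE mulnDr mulnS.
    have -> : (q - d)%N = u.+1 by lia.
    rewrite leq_mul2r /=; move: lt_s edE le_edb; rewrite mulnS.
    set k := (e * d)%N; set l := (e * s)%N; lia.
  exists q.-1, a; split; [lia|lia|lia| |by split=> //; lia].
  by move=> d le_da le_edb; apply: leq_mul; lia.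
exists #|monomials q e a b|, ((q - n) * (q - m))%N; split.
- have [U UP dimU] := has_dim_suppcode _ _ alpha (monomials q e a b) inj_alpha.
  by exists U => // v; rewrite UP; split => /affine_codeP; apply.
- exact: affine_code_min_dist.
- rewrite sA_tildeE //=; case: leqP => [le_qb|lt_bq].
    set s := minn _ a.
    have le_s : (e * ((b.+1 - q) %/ e) <= b.+1 - q)%N by rewrite mulnC leq_divM.
    have lt_s : (b.+1 - q < e * ((b.+1 - q) %/ e).+1)%N by rewrite mulnC ltn_ceil.
    have s1E : s%:Z%:~R + 1 = s.+1%:R :> rat by rewrite -pmulrn natr1.
    have sE : s%:Z%:~R = s.+1%:R - 1 :> rat by rewrite -s1E addrK.
    rewrite s1E sE; apply: card_monomials_rat => //; first by lia.
      by move=> d; nia.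
    move=> d /andP[lt_sd le_da].
    have lt_d : (((b.+1 - q) %/ e).+1 <= d)%N by lia.
    by move: lt_s; have := leq_mul (leqnn e) lt_d; lia.
  by rewrite (@card_monomials_rat _ _ _ _ 0) // => d _; lia.
- case: dE => [dE1 dE2 dE3]; split.
  + move=> lt_b; have [-> ->] : n = b /\ m = 0%N by apply: dE1; lia.
    by nia.
  + move=> lt_b; have [-> ->] : n = q.-1 /\ m = ((b.+1 - q) %/ e)%N by apply: dE2; lia.
    have -> : (b%:R - q%:R + 1 : rat) = (b.+1 - q)%N%:R.
      by rewrite natrB; [rewrite -natr1; ring|lia].
    rewrite floor_divn //.
    (* This makes the truncated subtraction from [q] agree with the integer one. *)
    have : ((b.+1 - q) %/ e < q)%N by rewrite ltn_divLR //; nia.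
    nia.
  + move=> le_ab; have [-> ->] : n = q.-1 /\ m = a by apply: dE3; lia.
    nia.
Qed.
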